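(* Let $q$ be an odd prime, and let $i,i',j,j'$ be any integers with $1\le 2i,\,2i'+1\le (q-3)/2$ and $1\le 2j,\,2j'+1\le (q-1)/2$. Then $$\dim\psi^{\langle z\rangle}=q,\quad \dim\chi_{2i}^{\langle z\rangle}=q+1,\quad \dim\theta_{2j}^{\langle z\rangle}=q-1,\quad \dim(2\chi_{2i'+1})^{\langle z\rangle}=\dim(2\theta_{2j'+1})^{\langle z\rangle}=0;$$ if $q\equiv 1\pmod 4$, then $\dim\xi_k^{\langle z\rangle}=(q+1)/2$ and $\dim(2\eta_k)^{\langle z\rangle}=0$ for $k=1,2$; if $q\equiv 3\pmod 4$, then $\dim(2\operatorname{Re}\xi_1)^{\langle z\rangle}=0$ and $\dim(2\operatorname{Re}\eta_1)^{\langle z\rangle}=q-1$. Moreover, for $H=\langle c\rangle$ or $H=\langle d\rangle$, $$\dim\psi^H=1,\quad \dim\chi_{2i}^H=2,\quad \dim(2\chi_{2i'+1})^H=4,\quad \dim\theta_{2j}^H=\dim(2\theta_{2j'+1})^H=0;$$ if $q\equiv 1\pmod 4$, then $\dim\xi_k^H=1$ and $\dim(2\eta_k)^H=0$ for $k=1,2$; if $q\equiv 3\pmod 4$, then $\dim(2\operatorname{Re}\xi_1)^H=2$ and $\dim(2\operatorname{Re}\eta_1)^H=0$.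
   Context: $\mathrm{SL}_2(q)$ is the group of $2\times 2$ matrices of determinant $1$ over $\mathbb{F}_q$. Let $\nu$ be a generator of $\mathbb{F}_q^\times$ and put $\mathbf{1}=\begin{pmatrix}1&0\\0&1\end{pmatrix}$, $z=\begin{pmatrix}-1&0\\0&-1\end{pmatrix}$, $c=\begin{pmatrix}1&0\\1&1\end{pmatrix}$, $d=\begin{pmatrix}1&0\\ \nu&1\end{pmatrix}$, $a=\begin{pmatrix}\nu&0\\0&\nu^{-1}\end{pmatrix}$, and let $b$ be an element of order $q+1$. The conjugacy classes of $\mathrm{SL}_2(q)$ are represented by $\mathbf{1},z,c,d,zc,zd,a^l,b^m$ with $1\le l\le (q-3)/2$, $1\le m\le (q-1)/2$. Let $\epsilon=(-1)^{(q-1)/2}$, $\zeta_r=\exp(2\pi \sqrt{-1}/r)$ and $\nu_r^s=\zeta_r^s+\zeta_r^{-s}$. The complex irreducible characters of $\mathrm{SL}_2(q)$ are the following, with $1\le i\le (q-3)/2$ and $1\le j\le (q-1)/2$: $$\begin{array}{l|cccccc} & \mathbf{1} & z & c & d & a^l & b^m\\ \hline \mathbf{1} & 1&1&1&1&1&1\\ \psi & q&q&0&0&1&-1\\ \chi_i & q+1&(-1)^i(q+1)&1&1&\nu_{q-1}^{il}&0\\ \theta_j & q-1&(-1)^j(q-1)&-1&-1&0&-\nu_{q+1}^{jm}\\ \xi_1 & \frac{q+1}{2}&\frac{\epsilon(q+1)}{2}&\frac{1+\sqrt{\epsilon q}}{2}&\frac{1-\sqrt{\epsilon q}}{2}&(-1)^l&0\\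 \xi_2 & \frac{q+1}{2}&\frac{\epsilon(q+1)}{2}&\frac{1-\sqrt{\epsilon q}}{2}&\frac{1+\sqrt{\epsilon q}}{2}&(-1)^l&0\\ \eta_1 & \frac{q-1}{2}&-\frac{\epsilon(q-1)}{2}&\frac{-1+\sqrt{\epsilon q}}{2}&\frac{-1-\sqrt{\epsilon q}}{2}&0&(-1)^{m+1}\\ \eta_2 & \frac{q-1}{2}&-\frac{\epsilon(q-1)}{2}&\frac{-1-\sqrt{\epsilon q}}{2}&\frac{-1+\sqrt{\epsilon q}}{2}&0&(-1)^{m+1}\end{array}$$ and $\chi(zc)=\frac{\chi(z)}{\chi(\mathbf 1)}\chi(c)$, $\chi(zd)=\frac{\chi(z)}{\chi(\mathbf 1)}\chi(d)$ for each of these characters $\chi$. The characters of the real irreducible representations of $\mathrm{SL}_2(q)$ are $\mathbf{1},\psi,\chi_{2i},2\chi_{2i'+1},\theta_{2j},2\theta_{2j'+1}$ (with $1\le 2i,2i'+1\le (q-3)/2$, $1\le 2j,2j'+1\le (q-1)/2$), together with $\xi_1,\xi_2,2\eta_1,2\eta_2$ if $q\equiv 1\pmod 4$, and $2\operatorname{Re}\xi_1=\xi_1+\xi_2$, $2\operatorname{Re}\eta_1=\eta_1+\eta_2$ if $q\equiv 3\pmod 4$. For such a character $\chi$ and a subgroup $H\le \mathrm{SL}_2(q)$, $\dim\chi^H$ denotes $\dim_{\mathbb{R}}V^H$, where $V$ is the real irreducible representation with character $\chi$ and $V^H$ its subspace of $H$-fixed vectors. *)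

(* Defs.v *)
From HB Require Import structures.
From mathcomp Require Import all_boot all_order all_algebra all_fingroup.
From mathcomp Require Import all_solvable all_field all_character.
From mathcomp Require Import complex.
From mathcomp Require Import reals trigo.

Set Implicit Arguments.
Unset Strict Implicit.
Unset Printing Implicit Defensive.

Import Order.TTheory GRing.Theory Num.Theory.

Local Open Scope ring_scope.

Section SL2.
Variable q : nat.

Definition SL2 : {set {'GL_2(q)}} := [set g | \det (GLval g) == 1].

Lemma SL2_group_set : group_set SL2.
Proof.
apply/group_setP; split; first by rewrite inE GL_1E det1.
by move=> g h; rewrite !inE GL_ME det_mulmx => /eqP-> /eqP->; rewrite mulr1.
Qed.
Canonical SL2_group := Group SL2_group_set.

Definition lower_mx (x y w : 'F_q) : 'M['F_q]_2 :=
  block_mx (x%:M : 'M_1) 0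
           (y%:M : 'M_1) (w%:M : 'M_1).

Lemma lower_mx_det x y w : \det (lower_mx x y w) = x * w.
Proof.
rewrite -[x in RHS]det_scalar1 -[w in RHS]det_scalar1.
exact: (det_lblock (x%:M : 'M_1) (y%:M : 'M_1) w%:M).
Qed.

Lemma lower_mx_unit x y w : x * w = 1 -> lower_mx x y w \is a GRing.unit.
Proof.
move=> xw1; have: lower_mx x y w \in unitmx.
  by rewrite unitmxE lower_mx_det xw1 unitr1.
by [].
Qed.

Definition lower (x y w : 'F_q) (xw1 : x * w = 1) : {'GL_2(q)} :=
  FinRing.unit 'M['F_q]_2 (lower_mx_unit y xw1).

Lemma lower_SL2 x y w (xw1 : x * w = 1) : lower y xw1 \in SL2.
Proof. by rewrite inE /= lower_mx_det xw1. Qed.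

Definition sl2_z : {'GL_2(q)} :=
  lower 0 (etrans (mulrNN 1 1) (mulr1 1) : (-1) * (-1) = 1 :> 'F_q).

Definition sl2_c : {'GL_2(q)} := lower 1 (mulr1 1 : 1 * 1 = 1 :> 'F_q).

Definition sl2_d (nu : {unit 'F_q}) : {'GL_2(q)} :=
  lower (val nu) (mulr1 1 : 1 * 1 = 1 :> 'F_q).

Definition sl2_a (nu : {unit 'F_q}) : {'GL_2(q)} :=
  lower 0 (mulrV (valP nu) : val nu * (val nu)^-1 = 1).

End SL2.

Section CharacterTable.
Variables (R : realType) (q : nat).
Local Notation C := R[i].
Local Notation gT := {'GL_2(q)}.

Definition zeta (r : nat) : C :=
  Complex (cos (2 * pi / r%:R)) (sin (2 * pi / r%:R)).

Definition nu_sum (r s : nat) : C := zeta r ^+ s + zeta r ^- s.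

Definition eps : C := (-1) ^+ ((q - 1) %/ 2)%N.

(* sqrtC is the principal root, so this is 'i * sqrt q when eps = -1. *)
Definition sqrt_eps_q : C := sqrtC (eps * q%:R).

(* A row of the character table: at_a l and at_b m are the values at a ^+ l
   and b ^+ m. *)
Record table_row := TableRow {
  at_1 : C; at_z : C; at_c : C; at_d : C; at_a : nat -> C; at_b : nat -> C }.

Definition psi_row : table_row :=
  TableRow q%:R q%:R 0 0 (fun _ => 1) (fun _ => -1).

Definition chi_row (i : nat) : table_row :=
  TableRow (q%:R + 1) ((-1) ^+ i * (q%:R + 1)) 1 1
           (fun l => nu_sum (q - 1) (i * l)) (fun _ => 0).

Definition theta_row (j : nat) : table_row :=
  TableRow (q%:R - 1) ((-1) ^+ j * (q%:R - 1)) (-1) (-1)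
           (fun _ => 0) (fun m => - nu_sum (q + 1) (j * m)).

Definition xi1_row : table_row :=
  TableRow ((q%:R + 1) / 2) (eps * (q%:R + 1) / 2)
           ((1 + sqrt_eps_q) / 2) ((1 - sqrt_eps_q) / 2)
           (fun l => (-1) ^+ l) (fun _ => 0).

Definition xi2_row : table_row :=
  TableRow ((q%:R + 1) / 2) (eps * (q%:R + 1) / 2)
           ((1 - sqrt_eps_q) / 2) ((1 + sqrt_eps_q) / 2)
           (fun l => (-1) ^+ l) (fun _ => 0).

Definition eta1_row : table_row :=
  TableRow ((q%:R - 1) / 2) (- (eps * (q%:R - 1) / 2))
           ((-1 + sqrt_eps_q) / 2) ((-1 - sqrt_eps_q) / 2)
           (fun _ => 0) (fun m => (-1) ^+ m.+1).

Definition eta2_row : table_row :=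
  TableRow ((q%:R - 1) / 2) (- (eps * (q%:R - 1) / 2))
           ((-1 - sqrt_eps_q) / 2) ((-1 + sqrt_eps_q) / 2)
           (fun _ => 0) (fun m => (-1) ^+ m.+1).

Definition has_values (nu : {unit 'F_q}) (b : gT) (v : table_row)
    (chi : gT -> C) : Prop :=
  [/\ [/\ chi 1%g = at_1 v, chi (sl2_z q) = at_z v,
          chi (sl2_c q) = at_c v & chi (sl2_d nu) = at_d v],
      chi (sl2_z q * sl2_c q)%g = at_z v / at_1 v * at_c v,
      chi (sl2_z q * sl2_d nu)%g = at_z v / at_1 v * at_d v,
      forall l, (1 <= l <= (q - 3) %/ 2)%N -> chi (sl2_a nu ^+ l)%g = at_a v l
    & forall m, (1 <= m <= (q - 1) %/ 2)%N -> chi (b ^+ m)%g = at_b v m].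

(* Only the values of chi on SL2 q matter. *)
Definition complex_irr (chi : gT -> C) : Prop :=
  exists (n : nat) (rW : mx_representation C (SL2_group q) n),
    mx_irreducible rW /\ {in SL2 q, forall x, chi x = \tr (rW x)}.

Definition is_table_char (nu : {unit 'F_q}) (b : gT) (v : table_row)
    (chi : gT -> C) : Prop :=
  complex_irr chi /\ has_values nu b v chi.

(* dim chi ^ H = k: the fixed space of H has dimension k in every real
   irreducible representation with character chi (such a representation is
   unique up to isomorphism). *)
Definition dim_fixed (chi : gT -> C) (H : {set gT}) (k : nat) : Prop :=
  forall (n : nat) (rV : mx_representation R (SL2_group q) n),
    mx_irreducible rV ->
    {in SL2 q, forall x, real_complex R (\tr (rV x)) = chi x} ->
    \rank (rfix_mx rV H) = k.

End CharacterTable.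

(* Main.v *)
Require Import Defs.
From HB Require Import structures.
From mathcomp Require Import all_boot all_order all_algebra all_fingroup.
From mathcomp Require Import all_solvable all_field all_character.
From mathcomp Require Import complex.
From mathcomp Require Import reals trigo.
From mathcomp Require Import ring zify.

Set Implicit Arguments.
Unset Strict Implicit.
Unset Printing Implicit Defensive.

Import Order.TTheory GRing.Theory Num.Theory.

Local Open Scope ring_scope.

(** The fixed space of a group H of order invertible in the field is the image
    of the idempotent [|H|^-1 * \sum_(h in H) rho h], and the trace of an
    idempotent is its rank; so [|H| * dim V^H] is the sum of the character over
    H ([rank_rfix_mx]).  Everything then reduces to summing table values.

    For H = <z>, of order 2, the sum is chi(1) + chi(z).

    The groups <c> and <d> are both equal to the group of all lower
    unitriangular matrices u(y), with y in F_q ([cycle_transv]).  Conjugation by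
    diag(s, s^-1) maps u(y) to u(y s^2), so the character only depends on the
    class of y modulo squares.  Multiplication by the generator nu exchanges the
    squares and the non-squares of F_q^*, hence
    [chi(u(y)) + chi(u(nu y)) = chi(c) + chi(d)] for all nonzero y, and summing
    over y gives
    [2 * \sum_(h in H) chi(h) = 2 chi(1) + (q - 1)(chi(c) + chi(d))]
    ([sum_square_classes]).  Only chi(c) + chi(d) matters, and the square roots
    of eps * q in the table cancel. *)

(** * Dimension of fixed spaces *)

(** Write P = C R with C of full column rank and R of full row rank r; then
    C R C R = C R forces R C = 1, an identity of size r, and
    tr (C R) = tr (R C). *)
Lemma mxtrace_idempotent (F : fieldType) (n : nat) (P : 'M[F]_n) :
  P *m P = P -> \tr P = (\rank P)%:R.
Proof.
move=> PP; have RC1: row_base P *m col_base P = 1%:M.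
  apply: (row_free_inj (row_base_free P)).
  apply: (row_full_inj (col_base_full P)).
  rewrite mul1mx mulmx_base mulmxA (mulmxA (col_base P)) mulmx_base -mulmxA.
  by rewrite mulmx_base.
by rewrite -[P in LHS]mulmx_base mxtrace_mulC RC1 mxtrace1.
Qed.

(** The sum s of the rho(h) has image in the fixed space and acts on it as the
    scalar |H|, so s / |H| is an idempotent whose image is the fixed space. *)
Lemma rank_rfix_mx (F : fieldType) (gT : finGroupType) (G H : {group gT})
    (n : nat) (rG : mx_representation F G n) :
    H \subset G -> #|H|%:R != 0 :> F ->
  #|H|%:R * (\rank (rfix_mx rG H))%:R = \sum_(h in H) \tr (rG h).
Proof.
move=> sHG nzH; set s : 'M[F]_n := \sum_(h in H) rG h.
have fix_s: (s <= rfix_mx rG H)%MS.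
  apply/rfix_mxP=> x Hx; rewrite mulmx_suml [RHS](reindex_inj (mulIg x)) /=.
  apply: eq_big => [h|h Hh]; first by rewrite groupMr.
  by rewrite repr_mxM ?(subsetP sHG).
have mul_s m (W : 'M_(m, n)) : (W <= rfix_mx rG H)%MS -> W *m s = #|H|%:R *: W.
  move/rfix_mxP=> fixW; rewrite mulmx_sumr (eq_bigr _ fixW).
  by rewrite sumr_const scaler_nat.
pose P := #|H|%:R^-1 *: s.
have eqP: \rank (rfix_mx rG H) = \rank P.
  apply/eqmx_rank/andP; split; last exact: scalemx_sub.
  apply/submxP; exists (rfix_mx rG H).
  by rewrite -scalemxAr mul_s // scalerA mulVf // scale1r.
rewrite eqP -mxtrace_idempotent; last first.
  by rewrite -scalemxAr mul_s ?scalemx_sub // scalerA mulVf // scale1r.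
by rewrite mxtraceZ mulVKf // raddf_sum.
Qed.

Lemma mxtrace_reprJ (F : fieldType) (gT : finGroupType) (G : {group gT})
    (n : nat) (rG : mx_representation F G n) (x g : gT) :
  x \in G -> g \in G -> \tr (rG (x ^ g)%g) = \tr (rG x).
Proof.
move=> Gx Gg; rewrite conjgE mulgA repr_mxM ?groupM ?groupV // mxtrace_mulC.
by rewrite -repr_mxM ?groupM ?groupV // mulKVg.
Qed.

(** * Lower unitriangular matrices in SL2(q) *)

Section Transvections.
Variable q : nat.

Lemma eq_lower x y w x' y' w' (e : x * w = 1) (e' : x' * w' = 1 :> 'F_q) :
  x = x' -> y = y' -> w = w' -> lower y e = lower y' e'.
Proof. by move=> ex ey ew; apply: val_inj; rewrite /= ex ey ew. Qed.

Lemma lower_mx_inj (x y w x' y' w' : 'F_q) :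
  lower_mx x y w = lower_mx x' y' w' -> [/\ x = x', y = y' & w = w'].
Proof.
have inj1 (u v : 'F_q) : u%:M = v%:M :> 'M_1 -> u = v.
  by move=> /matrixP/(_ 0 0); rewrite !mxE eqxx !mulr1n.
rewrite /lower_mx => /(@eq_block_mx _ 1 1 1 1) [/inj1 ex _ /inj1 ey /inj1 ew].
by split.
Qed.

(** The determinant condition e2 of the product is an argument, so that rewriting
    can produce whichever proof the context requires. *)
Lemma lowerM x y w x' y' w' (e : x * w = 1) (e' : x' * w' = 1 :> 'F_q)
    (e2 : (x * x') * (w * w') = 1) :
  (lower y e * lower y' e')%g = lower (y * x' + w * y') e2.
Proof.
apply: val_inj; change (lower_mx x y w *m lower_mx x' y' w' =
  lower_mx (x * x') (y * x' + w * y') (w * w')).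
(* the size 2 of lower_mx hides the block dimensions 1 + 1 *)
etransitivity; first exact: (@mulmx_block _ 1 1 1 1 1 1).
by rewrite /lower_mx !mul0mx !mulmx0 !addr0 !add0r raddfD /= !scalar_mxM.
Qed.

Definition transv (y : 'F_q) : {'GL_2(q)} :=
  lower y (mulr1 1 : 1 * 1 = 1 :> 'F_q).

Lemma transv_inj : injective transv.
Proof. by move=> y y' /(congr1 val) /lower_mx_inj []. Qed.

Lemma transvD y y' : transv (y + y') = (transv y * transv y')%g.
Proof.
have e : (1 * 1) * (1 * 1) = 1 :> 'F_q by rewrite !mulr1.
by rewrite (lowerM _ _ _ _ e); apply: eq_lower; rewrite ?mulr1 ?mul1r.
Qed.

Lemma transv0 : transv 0 = 1%g.
Proof. by apply: (mulgI (transv 0)); rewrite -transvD mulg1 addr0. Qed.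

Lemma transvMn y k : transv (y *+ k) = (transv y ^+ k)%g.
Proof.
elim: k => [|k IHk]; first by rewrite mulr0n expg0 transv0.
by rewrite mulrS transvD IHk expgS.
Qed.

(** 'F_q is always a prime field, so any nonzero t generates its additive group.
    In particular c = u(1) and d = u(nu) generate the same group. *)
Lemma cycle_transv t : t != 0 -> <[transv t]>%g = [set transv y | y : 'F_q].
Proof.
move=> nz_t; apply/setP=> g; apply/cycleP/imsetP=> [[k ->]|[y _ ->]].
  by exists (t *+ k); rewrite ?transvMn.
by exists (y / t)%R; rewrite -transvMn -mulr_natr natr_Zp mulrC divfK.
Qed.

(** This is why characters are constant on square classes of parameters. *)
Lemma transvJ y (s : {unit 'F_q}) :
  (transv y ^ sl2_a s)%g = transv (y * val s ^+ 2).
Proof.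
apply: (mulgI (sl2_a s)); rewrite -conjgC.
have sV := mulrV (valP s).
have e : (1 * val s) * (1 * (val s)^-1) = 1 by rewrite !mul1r.
have e' : (val s * 1) * ((val s)^-1 * 1) = 1 by rewrite !mulr1.
rewrite (lowerM _ _ _ _ e) (lowerM _ _ _ _ e').
apply: eq_lower; rewrite ?mul1r ?mulr1 //.
by rewrite add0r addr0 mulrCA expr2 (mulKr (valP s)).
Qed.

End Transvections.

Lemma order_sl2_z q : prime q -> odd q -> #[sl2_z q]%g = 2.
Proof.
move=> q_prime q_odd; apply: nt_prime_order => //.
  have e : ((-1) * (-1)) * ((-1) * (-1)) = 1 :> 'F_q by rewrite mulrNN !mulr1.
  rewrite expgS expg1 (lowerM _ _ _ _ e) -(transv0 q).
  by apply: eq_lower; rewrite ?mulrNN ?mulr1 // mul0r mulr0 addr0.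
rewrite -(transv0 q); apply/eqP=> /(congr1 val) /lower_mx_inj [/eqP + _ _].
rewrite eq_sym -addr_eq0 -(natrD _ 1 1).
rewrite -(dvdn_pcharf (pchar_Fp q_prime)).
by rewrite dvdn_prime2 // => /eqP q2; rewrite q2 in q_odd.
Qed.

(** * Sums over the additive group of F_q *)

Section Sums.
Variables (q : nat) (q_prime : prime q) (nu : {unit 'F_q}).
Hypothesis nu_gen : generator [set: {unit 'F_q}] nu.
Variable V : nmodType.

(** Multiplication by nu permutes the nonzero elements and swaps the square
    classes of 1 and nu, so twice the sum over nonzero y is a sum of q - 1 equal
    terms f(y) + f(nu y). Doubling avoids having to count squares. *)
Lemma sum_square_classes (f : 'F_q -> V) :
  (forall y (s : {unit 'F_q}), f (y * val s ^+ 2) = f y) ->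
  (\sum_y f y) *+ 2 = f 0 *+ 2 + (f 1 + f (val nu)) *+ q.-1.
Proof.
move=> f_sq; rewrite (bigD1 0) //= mulrnDl; congr (_ + _).
have pair_nu y : y != 0 -> f y + f (val nu * y) = f 1 + f (val nu).
  rewrite -unitfE => Uy; pose s : {unit 'F_q} := Sub y Uy.
  (* y = nu ^ k, and k is reduced to its parity by extracting a square *)
  have: s \in <[nu]>%g by rewrite -(eqP nu_gen) inE.
  case/cycleP=> k /(congr1 val); rewrite /= FinRing.val_unitX => ->.
  rewrite -(odd_double_half k) exprD -mul2n mulnC exprM.
  rewrite -(FinRing.val_unitX (k./2) nu) mulrA !f_sq.
  case: (odd k) => /=; last by rewrite mulr1.
  by rewrite expr1 -expr2 -[val nu ^+ 2]mul1r f_sq addrC.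
have nz_nu : val nu != 0 by rewrite -unitfE (valP nu).
rewrite mulr2n {2}(reindex_inj (mulfI nz_nu)) /=.
under [X in _ + X]eq_bigl => y do rewrite mulf_eq0 (negPf nz_nu) /=.
rewrite -big_split /= (eq_bigr _ pair_nu) sumr_const; congr (_ *+ _).
by rewrite cardC1 card_Fp.
Qed.

End Sums.

(** * Fixed spaces of <z>, <c> and <d> from character values *)

Lemma SL2_transv q y : transv y \in SL2 q.
Proof. exact: lower_SL2. Qed.

Lemma rank_rfix_transv (F : fieldType) (q n : nat)
    (rV : mx_representation F (SL2_group q) n) (nu : {unit 'F_q}) t :
    prime q -> generator [set: {unit 'F_q}] nu -> t != 0 -> q%:R != 0 :> F ->
  (2 * q * \rank (rfix_mx rV <[transv t]>%g))%:R
    = 2 * \tr (rV 1%g) + q.-1%:R * (\tr (rV (sl2_c q)) + \tr (rV (sl2_d nu))).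
Proof.
move=> q_pr nu_gen nz_t nz_q.
have cardU : #|<[transv t]>%g| = q.
  by rewrite cycle_transv // card_imset ?card_Fp //; exact: transv_inj.
have sUG : <[transv t]>%g \subset SL2_group q by rewrite cycle_subG SL2_transv.
have := rank_rfix_mx rV sUG; rewrite cardU => /(_ nz_q).
rewrite -mulnA natrM natrM => ->.
rewrite /= cycle_transv // big_imset /=; last by move=> y y' _ _ /transv_inj.
rewrite mulr_natl (sum_square_classes q_pr nu_gen) => [|y s].
  by rewrite transv0 !mulr_natl.
by rewrite -(transvJ y s) mxtrace_reprJ ?SL2_transv ?lower_SL2.
Qed.

Lemma dim_fixed_transv (R : realType) (q k : nat) (chi : {'GL_2(q)} -> R[i])
    (nu : {unit 'F_q}) t :
    prime q -> generator [set: {unit 'F_q}] nu -> t != 0 ->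
    2 * chi 1%g + q.-1%:R * (chi (sl2_c q) + chi (sl2_d nu)) = (2 * q * k)%:R ->
  dim_fixed chi <[transv t]>%g k.
Proof.
move=> q_pr nu_gen nz_t def_k n rV _ tr_rV; have q_gt0 := prime_gt0 q_pr.
have nz_q : q%:R != 0 :> R by rewrite pnatr_eq0 -lt0n.
apply/eqP; rewrite -(@eqn_pmul2l (2 * q)) ?muln_gt0 // -(eqr_nat R[i]) -def_k.
rewrite -[X in X == _](rmorph_nat (real_complex R)).
rewrite (rank_rfix_transv _ q_pr nu_gen) //.
by rewrite rmorphD !rmorphM !rmorph_nat rmorphD -!tr_rV ?group1 ?lower_SL2.
Qed.

Lemma dim_fixed_z (R : realType) (q k : nat) (chi : {'GL_2(q)} -> R[i]) :
    prime q -> odd q -> chi 1%g + chi (sl2_z q) = (2 * k)%:R ->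
  dim_fixed chi <[sl2_z q]>%g k.
Proof.
move=> q_pr q_odd def_k n rV _ tr_rV.
have sZG : <[sl2_z q]>%g \subset SL2_group q by rewrite cycle_subG lower_SL2.
have oZ := order_sl2_z q_pr q_odd.
apply/eqP; rewrite -(@eqn_pmul2l 2) // -(eqr_nat R[i]) -def_k.
rewrite -[X in X == _](rmorph_nat (real_complex R)) natrM.
have := rank_rfix_mx rV sZG; rewrite -orderE oZ pnatr_eq0 => /(_ isT) ->.
rewrite /= (cycle2g oZ) big_setU1 ?big_set1 /=; last first.
  by rewrite inE eq_sym -order_eq1 oZ.
by rewrite rmorphD /= !tr_rV ?group1 ?lower_SL2.
Qed.

Lemma natr_pred_prime (R : realType) q : prime q -> q.-1%:R = q%:R - 1 :> R[i].
Proof. by move=> q_pr; rewrite -subn1 natrB ?prime_gt0. Qed.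

(** For 2 Re chi the relevant sum is twice the real part of a linear combination,
    with real coefficients, of values of chi; when that combination is a natural
    number, so is the sum, and no individual real part is needed. *)
Lemma dim_fixed_z_Re (R : realType) q k (chi : {'GL_2(q)} -> R[i]) :
    prime q -> odd q ->
    chi 1%g + chi (sl2_z q) = k%:R ->
  dim_fixed (fun x => 2 * 'Re (chi x)) <[sl2_z q]>%g k.
Proof.
move=> q_pr q_odd def_k; apply: dim_fixed_z => //.
by rewrite -mulrDr -raddfD /= def_k natrM (Creal_ReP _ _) ?realn.
Qed.

Lemma dim_fixed_transv_Re (R : realType) q k (chi : {'GL_2(q)} -> R[i])
    (nu : {unit 'F_q}) t :
    prime q -> generator [set: {unit 'F_q}] nu -> t != 0 ->
    2 * chi 1%g + q.-1%:R * (chi (sl2_c q) + chi (sl2_d nu)) = (q * k)%:R ->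
  dim_fixed (fun x => 2 * 'Re (chi x)) <[transv t]>%g k.
Proof.
move=> q_pr nu_gen nz_t def_k; apply: (dim_fixed_transv q_pr nu_gen nz_t).
rewrite -mulrDr -raddfD /= -mulnA [RHS]natrM -def_k.
transitivity
  (2 * 'Re (2 * chi 1%g + q.-1%:R * (chi (sl2_c q) + chi (sl2_d nu)))).
  rewrite [in RHS]raddfD /= !ReMl ?realn // mulrDr.
  by congr (_ + _); exact: mulrCA.
by rewrite def_k (Creal_ReP _ _) ?realn.
Qed.

(** * The character table *)

Lemma eps_1mod4 R q : (q = 1 %[mod 4])%N -> eps R q = 1.
Proof.
by move=> q1; rewrite /eps -signr_odd (_ : odd _ = false) //; apply/negbTE; lia.
Qed.

Lemma eps_3mod4 R q : (q = 3 %[mod 4])%N -> eps R q = -1.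
Proof.
by move=> q3; rewrite /eps -signr_odd (_ : odd _ = true) //; lia.
Qed.

Theorem lemma4 (R : realType) (q : nat) (q_prime : prime q) (q_odd : odd q)
  (nu : {unit 'F_q}) (nu_gen : generator [set: {unit 'F_q}] nu)
  (b : {'GL_2(q)}) (b_SL2 : b \in SL2 q) (b_order : #[b]%g = q.+1)
  (psi : {'GL_2(q)} -> R[i]) (chi theta : nat -> {'GL_2(q)} -> R[i])
  (xi1 xi2 eta1 eta2 : {'GL_2(q)} -> R[i])
  (psiP : is_table_char nu b (psi_row R q) psi)
  (chiP : forall i, (1 <= i <= (q - 3) %/ 2)%N ->
     is_table_char nu b (chi_row R q i) (chi i))
  (thetaP : forall j, (1 <= j <= (q - 1) %/ 2)%N ->
     is_table_char nu b (theta_row R q j) (theta j))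
  (xi1P : is_table_char nu b (xi1_row R q) xi1)
  (xi2P : is_table_char nu b (xi2_row R q) xi2)
  (eta1P : is_table_char nu b (eta1_row R q) eta1)
  (eta2P : is_table_char nu b (eta2_row R q) eta2)
  (i i' j j' : nat) :
  let Z := <[sl2_z q]>%g in
  [/\ dim_fixed psi Z q,
      (1 <= 2 * i <= (q - 3) %/ 2)%N -> dim_fixed (chi (2 * i)%N) Z (q + 1),
      (1 <= 2 * j <= (q - 1) %/ 2)%N -> dim_fixed (theta (2 * j)%N) Z (q - 1),
      ((1 <= 2 * i' + 1 <= (q - 3) %/ 2)%N ->
         dim_fixed (fun x => 2 * chi (2 * i' + 1)%N x) Z 0) /\
      ((1 <= 2 * j' + 1 <= (q - 1) %/ 2)%N ->
         dim_fixed (fun x => 2 * theta (2 * j' + 1)%N x) Z 0)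
    & ((q = 1 %[mod 4])%N ->
         [/\ dim_fixed xi1 Z ((q + 1) %/ 2), dim_fixed xi2 Z ((q + 1) %/ 2),
             dim_fixed (fun x => 2 * eta1 x) Z 0
           & dim_fixed (fun x => 2 * eta2 x) Z 0]) /\
      ((q = 3 %[mod 4])%N ->
         dim_fixed (fun x => 2 * 'Re (xi1 x)) Z 0 /\
         dim_fixed (fun x => 2 * 'Re (eta1 x)) Z (q - 1))]
  /\
  forall H : {set {'GL_2(q)}},
    H = <[sl2_c q]>%g \/ H = <[sl2_d nu]>%g ->
  [/\ dim_fixed psi H 1,
      (1 <= 2 * i <= (q - 3) %/ 2)%N -> dim_fixed (chi (2 * i)%N) H 2,
      (1 <= 2 * i' + 1 <= (q - 3) %/ 2)%N ->
         dim_fixed (fun x => 2 * chi (2 * i' + 1)%N x) H 4,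
      ((1 <= 2 * j <= (q - 1) %/ 2)%N -> dim_fixed (theta (2 * j)%N) H 0) /\
      ((1 <= 2 * j' + 1 <= (q - 1) %/ 2)%N ->
         dim_fixed (fun x => 2 * theta (2 * j' + 1)%N x) H 0)
    & ((q = 1 %[mod 4])%N ->
         [/\ dim_fixed xi1 H 1, dim_fixed xi2 H 1,
             dim_fixed (fun x => 2 * eta1 x) H 0
           & dim_fixed (fun x => 2 * eta2 x) H 0]) /\
      ((q = 3 %[mod 4])%N ->
         dim_fixed (fun x => 2 * 'Re (xi1 x)) H 2 /\
         dim_fixed (fun x => 2 * 'Re (eta1 x)) H 0)].
Proof.
move=> Z; have nat_pred := natr_pred_prime R q_prime.
have half_succ : (2 * ((q + 1) %/ 2) = q + 1)%N by lia.
have sub1 : (q - 1)%:R = q%:R - 1 :> R[i] by rewrite natrB ?prime_gt0.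
have odd2 n : (-1) ^+ (2 * n + 1) = -1 :> R[i].
  by rewrite addn1 exprS exprM sqrrN !expr1n mulr1.
have even2 n : (-1) ^+ (2 * n) = 1 :> R[i].
  by rewrite exprM sqrrN !expr1n.
have [_ [[p1 pz pc pd] _ _ _ _]] := psiP.
have [_ [[x1 xz xc xd] _ _ _ _]] := xi1P.
have [_ [[y1 yz yc yd] _ _ _ _]] := xi2P.
have [_ [[e1 ez ec ed] _ _ _ _]] := eta1P.
have [_ [[f1 fz fc fd] _ _ _ _]] := eta2P.
have chi_row_vals k : (1 <= k <= (q - 3) %/ 2)%N -> _ :=
  fun kP => let: conj _ (And5 h _ _ _ _) := chiP k kP in h.
have theta_row_vals k : (1 <= k <= (q - 1) %/ 2)%N -> _ :=
  fun kP => let: conj _ (And5 h _ _ _ _) := thetaP k kP in h.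
split.
  have fixZ := dim_fixed_z q_prime q_odd.
  have fixZRe := dim_fixed_z_Re q_prime q_odd.
  split.
  - by apply: fixZ; rewrite p1 pz /= natrM; ring.
  - move=> /chi_row_vals [c1 cz _ _]; apply: fixZ.
    by rewrite c1 cz /= even2 natrM natrD; ring.
  - move=> /theta_row_vals [c1 cz _ _]; apply: fixZ.
    by rewrite c1 cz /= even2 natrM sub1; ring.
  - by split=> [/chi_row_vals | /theta_row_vals] [c1 cz _ _]; apply: fixZ;
      rewrite c1 cz /= odd2; ring.
  split=> [/(eps_1mod4 R) eps1 | /(eps_3mod4 R) eps3]; split.
  - by apply: fixZ; rewrite x1 xz /= eps1 half_succ natrD; field.
  - by apply: fixZ; rewrite y1 yz /= eps1 half_succ natrD; field.
  - by apply: fixZ; rewrite e1 ez /= eps1; field.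
  - by apply: fixZ; rewrite f1 fz /= eps1; field.
  - by apply: fixZRe; rewrite x1 xz /= eps3; field.
  - by apply: fixZRe; rewrite e1 ez /= eps3 sub1; field.
move=> H defH; have [t nz_t ->] : exists2 t : 'F_q, t != 0 & H = <[transv t]>%g.
  case: defH => ->; [by exists 1; rewrite ?oner_eq0 | exists (val nu) => //].
  by rewrite -unitfE (valP nu).
have fixU := dim_fixed_transv q_prime nu_gen nz_t.
have fixURe := dim_fixed_transv_Re q_prime nu_gen nz_t.
split.
- by apply: fixU; rewrite p1 pc pd /= nat_pred !natrM; ring.
- move=> /chi_row_vals [c1 _ cc cd]; apply: fixU.
  by rewrite c1 cc cd /= nat_pred !natrM; ring.
- move=> /chi_row_vals [c1 _ cc cd]; apply: fixU.
  by rewrite c1 cc cd /= nat_pred !natrM; ring.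
- by split=> /theta_row_vals [c1 _ cc cd]; apply: fixU;
    rewrite c1 cc cd /= nat_pred !natrM; ring.
(* chi(c) + chi(d) is rational on each of these rows, so q mod 4 only decides
   which real characters occur *)
split=> _; split.
- by apply: fixU; rewrite x1 xc xd /= nat_pred !natrM; field.
- by apply: fixU; rewrite y1 yc yd /= nat_pred !natrM; field.
- by apply: fixU; rewrite e1 ec ed /= nat_pred !natrM; field.
- by apply: fixU; rewrite f1 fc fd /= nat_pred !natrM; field.
- by apply: fixURe; rewrite x1 xc xd /= nat_pred !natrM; field.
- by apply: fixURe; rewrite e1 ec ed /= nat_pred !natrM; field.
Qed.
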